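(* Let $(A,\ast,\Phi=\{\partial_1,\partial_2\})$ be a differential Zinbiel algebra. Let $(A,\cdot,\Phi)$ be the associated commutative differential algebra, $a\cdot b=a\ast b+b\ast a$, and let $(A,[\ ,\ ],\cdot)$ be the induced Poisson algebra of $(A,\cdot,\Phi)$, $[a,b]=\partial_1(a)\cdot\partial_2(b)-\partial_2(a)\cdot\partial_1(b)$. Let $(A,\diamond,\ast)$ be the induced pre-Poisson algebra of $(A,\ast,\Phi)$, $a\diamond b=\partial_1(a)\ast\partial_2(b)-\partial_2(a)\ast\partial_1(b)$. Let $\{e_1,\dots,e_n\}$ be a basis of $A$ and $\{e_1^*,\dots,e_n^*\}$ be the dual basis. Set $$r=\sum_{i=1}^n(e_i\otimes e_i^*-e_i^*\otimes e_i).$$ Then there is a Poisson bialgebra $(A\ltimes_{-L_\diamond^*,L_\ast^*}A^*,[\ ,\ ],\cdot,\delta,\Delta)$, where, writing $\hat A$ for $A\ltimes_{-L_\diamond^*,L_\ast^*}A^*$, $$\delta(x)=(\mathrm{id}\otimes\mathrm{ad}_{\hat A}(x)+\mathrm{ad}_{\hat A}(x)\otimes\mathrm{id})(r),\qquad\Delta(x)=(\mathrm{id}\otimes L_{\hat A}(x)-L_{\hat A}(x)\otimes\mathrm{id})(r),\qquad x\in\hat A.$$ Moreover, $(A\ltimes_{L_\ast^*}A^*,\cdot,\Delta,\Phi-\Phi^*,-\Phi+\Phi^* )$ is a commutative and cocommutative differential ASI bialgebra whose induced Poisson bialgebra is exactly $(A\ltimes_{-L_\diamond^*,L_\ast^*}A^*,[\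 ,\ ],\cdot,\delta,\Delta)$.
   Context: All vector spaces and algebras are finite-dimensional over a field $\mathbb F$ of characteristic $0$; ''algebra'' means associative algebra, not necessarily unital. $\sigma(a\otimes b)=b\otimes a$, $\tau(a\otimes b\otimes c)=c\otimes a\otimes b$. $L_A(a)b=a\cdot b$, $\mathrm{ad}_A(a)b=[a,b]$. Transposes are denoted by $*$; for $\mu\colon A\to\mathrm{End}(V)$, $\mu^*(a)=\mu(a)^*$ (no sign). Zinbiel algebra $(A,\ast)$: $a\ast(b\ast c)=(a\ast b)\ast c+(b\ast a)\ast c$. Differential Zinbiel algebra $(A,\ast,\Phi=\{\partial_1,\partial_2\})$: moreover $\partial_1,\partial_2$ are commuting linear maps with $\partial_k(a\ast b)=\partial_k(a)\ast b+a\ast\partial_k(b)$. $L_\diamond(a)b=a\diamond b$, $L_\ast(a)b=a\ast b$. $A\ltimes_{L_\ast^*}A^*$ is $A\oplus A^*$ with $(a+u)\cdot(b+v)=a\cdot b+L_\ast^*(a)v+L_\ast^*(b)u$; $A\ltimes_{-L_\diamond^*,L_\ast^*}A^*$ is $A\oplus A^*$ with the same product and the bracket $[a+u,b+v]=[a,b]-L_\diamond^*(a)v+L_\diamond^*(b)u$ ($a,b\in A$, $u,v\in A^*$). $\Phi-\Phi^*$ is the family of maps $a+u\mapsto\partial_k(a)-\partial_k^*(u)$ on $A\oplus A^*$ and $-\Phi+\Phi^*$ the family $a+u\mapsto-\partial_k(a)+\partial_k^*(u)$, $k=1,2$. Commutative and cocommutative ASI bialgebra $(A,\cdot,\Delta)$: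 $(A,\cdot)$ commutative algebra, $(A,\Delta)$ cocommutative coassociative coalgebra (counit not required), $\Delta(a\cdot b)=(L_A(b)\otimes\mathrm{id})\Delta(a)+(\mathrm{id}\otimes L_A(a))\Delta(b)$ and $(L_A(a)\otimes\mathrm{id}-\mathrm{id}\otimes L_A(a))\Delta(b)=\sigma((\mathrm{id}\otimes L_A(b)-L_A(b)\otimes\mathrm{id})\Delta(a))$. Commutative and cocommutative differential ASI bialgebra $(A,\cdot,\Delta,\{\partial_k\},\{\eth_k\})$: in addition the $\partial_k$ are commuting derivations of $(A,\cdot)$, the $\eth_k$ are commuting with $\Delta\eth_k=(\eth_k\otimes\mathrm{id}+\mathrm{id}\otimes\eth_k)\Delta$, and $\eth_k(a)\cdot b=a\cdot\partial_k(b)+\eth_k(a\cdot b)$, $a\cdot\eth_k(b)=\partial_k(a)\cdot b+\eth_k(a\cdot b)$, $(\partial_k\otimes\mathrm{id})\Delta=(\mathrm{id}\otimes\eth_k)\Delta+\Delta\partial_k$, $(\mathrm{id}\otimes\partial_k)\Delta=(\eth_k\otimes\mathrm{id})\Delta+\Delta\partial_k$. If such a structure (with $k=1,2$) satisfies $\eth_2(\partial_1(a))\cdot b=\eth_1(\partial_2(a))\cdot b$ for all $a,b$ and $(\eth_2\partial_1\otimes\mathrm{id})\Delta=(\eth_1\partial_2\otimes\mathrm{id})\Delta$, its induced Poisson bialgebra is $(A,[\ ,\ ],\cdot,\delta,\Delta)$ with $[a,b]=\partial_1(a)\cdot\partial_2(b)-\partial_2(a)\cdot\partial_1(b)$ and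 $\delta=(\eth_1\otimes\eth_2-\eth_2\otimes\eth_1)\Delta$. Poisson algebra $(A,[\ ,\ ],\cdot)$: Lie bracket, commutative associative product, $[a,b\cdot c]=[a,b]\cdot c+b\cdot[a,c]$. Poisson coalgebra $(A,\delta,\Delta)$: $\delta=-\sigma\delta$, $(\mathrm{id}+\tau+\tau^2)(\mathrm{id}\otimes\delta)\delta=0$, $\Delta$ coassociative and cocommutative, $(\mathrm{id}\otimes\Delta)\delta(a)=(\delta\otimes\mathrm{id})\Delta(a)+(\sigma\otimes\mathrm{id})(\mathrm{id}\otimes\delta)\Delta(a)$. Poisson bialgebra $(A,[\ ,\ ],\cdot,\delta,\Delta)$: $(A,[\ ,\ ],\cdot)$ is a Poisson algebra, $(A,\delta,\Delta)$ is a Poisson coalgebra, $(A,\cdot,\Delta)$ is a commutative and cocommutative ASI bialgebra, $\delta([a,b])=(\mathrm{ad}_A(a)\otimes\mathrm{id}+\mathrm{id}\otimes\mathrm{ad}_A(a))\delta(b)-(\mathrm{ad}_A(b)\otimes\mathrm{id}+\mathrm{id}\otimes\mathrm{ad}_A(b))\delta(a)$, $\delta(a\cdot b)=(L_A(a)\otimes\mathrm{id})\delta(b)+(L_A(b)\otimes\mathrm{id})\delta(a)+(\mathrm{id}\otimes\mathrm{ad}_A(a))\Delta(b)+(\mathrm{id}\otimes\mathrm{ad}_A(b))\Delta(a)$, and $\Delta([a,b])=(\mathrm{ad}_A(a)\otimes\mathrm{id}+\mathrm{id}\otimes\mathrm{ad}_A(a))\Delta(b)+(L_A(b)\otimes\mathrm{id}-\mathrm{id}\otimes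 L_A(b))\delta(a)$. *)

(* Defs.v *)
From HB Require Import structures.
From mathcomp Require Import all_boot all_algebra.

Set Implicit Arguments.
Unset Strict Implicit.
Unset Printing Implicit Defensive.

Import GRing.Theory.
Local Open Scope ring_scope.

(* A bilinear map U x V -> W is an element of 'Hom(U, 'Hom(V, W)).  For a
   product mul : 'Hom(A, 'End(A)), the operator L_A(a) is therefore mul a, and
   for a bracket br the operator ad_A(a) is br a.  lin and bifun are
   meaningful only on (bi)linear functions; each use below comes with a lemma
   evaluating the resulting map. *)

Section LinearMaps.
Variable F : fieldType.
Implicit Types A U V W X : vectType F.

Definition lin U V (f : U -> V) : 'Hom(U, V) := linfun f.

Lemma linE U V (f : U -> V) : linear f -> lin f =1 f.
Proof.
move=> fL x; rewrite /lin.
pose m := GRing.isLinear.Build F U V *:%R f fL.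
pose f' : {linear U -> V} := HB.pack f m.
exact: (lfunE f').
Qed.

Definition bifun U V W (f : U -> V -> W) : 'Hom(U, 'Hom(V, W)) :=
  lin (fun u => lin (f u)).

Lemma bifunE U V W (f : U -> V -> W) :
  bilinear_for *:%R *:%R f -> forall u v, bifun f u v = f u v.
Proof.
move=> [fl fr] u v.
have E w : lin (f w) =1 f w by apply: linE; exact: fr.
rewrite /bifun linE ?E// => k x y.
by apply/lfunP => z; rewrite !lfunE /= !lfunE /= !E; exact: fl.
Qed.

Definition dual V : vectType F := 'Hom(V, (F^o : vectType F)).

Definition ev V (phi : dual V) (v : V) : F :=
  (phi : 'Hom(V, (F^o : vectType F))) v.

Lemma dual_ext V (phi psi : dual V) : ev phi =1 ev psi -> phi = psi.
Proof. by move=> E; apply/lfunP => v; exact: E. Qed.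

Lemma ev_linear V (phi : dual V) : linear (ev phi : V -> F^o).
Proof. by move=> k x y; rewrite /ev linearP. Qed.

Lemma evP V (phi psi : dual V) k v :
  ev (k *: phi + psi) v = k * ev phi v + ev psi v.
Proof. by rewrite /ev !lfunE /= !lfunE. Qed.

Definition transp U V (f : 'Hom(U, V)) : 'Hom(dual V, dual U) :=
  @lin (dual V) (dual U) (fun phi => (phi \o f)%VF).

Lemma transpE U V (f : 'Hom(U, V)) (phi : dual V) u :
  ev (transp f phi) u = ev phi (f u).
Proof.
have L : linear (fun phi : dual V => (phi \o f)%VF : dual U).
  by move=> k x y; apply/lfunP => z; rewrite !lfunE /= !lfunE /= !lfunE.
by rewrite /ev /transp (@linE (dual V) (dual U) _ L) lfunE.
Qed.

(* mu^*(a) = mu(a)^*, without sign *)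
Definition dual_rep A V (mu : 'Hom(A, 'End(V))) : 'Hom(A, 'End(dual V)) :=
  lin (fun a => transp (mu a)).

Lemma dual_repE A V (mu : 'Hom(A, 'End(V))) a : dual_rep mu a = transp (mu a).
Proof.
rewrite /dual_rep linE// => k x y.
apply/lfunP => phi; apply: dual_ext => v; rewrite !lfunE /= !lfunE /= evP.
by rewrite !transpE linearP !lfunE /= !lfunE; exact: ev_linear.
Qed.

Definition dual_basis V n (e : n.-tuple V) (es : n.-tuple (dual V)) : Prop :=
  forall i j : 'I_n, ev (tnth es i) (tnth e j) = (i == j)%:R.

End LinearMaps.

(* The tensor product of U and V is modelled by coordinate matrices with respect
   to the bases (vbasis {:U})_i (x) (vbasis {:V})_j; tlift and tlift_tens give
   its universal property, and tensor_ext says that pure tensors span. *)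
Section Tensor.
Variable F : fieldType.
Implicit Types A U V W X : vectType F.

Definition tensor U V : vectType F := 'M[F]_(\dim {:U}, \dim {:V}).

Definition tens U V (u : U) (v : V) : tensor U V :=
  \matrix_(i, j) (coord (vbasis {:U}) i u * coord (vbasis {:V}) j v).

Definition tlift U V W (f : U -> V -> W) : 'Hom(tensor U V, W) :=
  lin (fun t : 'M[F]_(\dim {:U}, \dim {:V}) =>
    \sum_i \sum_j t i j *: f (vbasis {:U})`_i (vbasis {:V})`_j).

Lemma tens_bilinear U V : bilinear_for *:%R *:%R (@tens U V).
Proof.
split=> [v k x y|u k x y]; apply/matrixP => i j; rewrite !mxE linearP /=.
  by rewrite mulrDl mulrA.
by rewrite mulrDr mulrCA.
Qed.

Lemma tlift_tens U V W (f : U -> V -> W) :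
  bilinear_for *:%R *:%R f -> forall u v, tlift f (tens u v) = f u v.
Proof.
move=> [fl fr] u v; rewrite /tlift linE; last first.
  move=> k x y; rewrite scaler_sumr -big_split; apply: eq_bigr => i _ /=.
  rewrite scaler_sumr -big_split; apply: eq_bigr => j _ /=.
  by rewrite !mxE scalerDl scalerA.
rewrite -[RHS](linE (fl v)) [in RHS](coord_vbasis (memvf u)) linear_sum.
apply: eq_bigr => i _; rewrite linearZ /= (linE (fl v)) -(linE (fr _) v).
rewrite [in RHS](coord_vbasis (memvf v)) linear_sum scaler_sumr.
by apply: eq_bigr => j _; rewrite mxE linearZ /= (linE (fr _)) scalerA.
Qed.

Lemma tensor_ext U V W (f g : 'Hom(tensor U V, W)) :
  (forall u v, f (tens u v) = g (tens u v)) -> f = g.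
Proof.
move=> fg; apply/lfunP => t.
have -> : t = \sum_i \sum_j (t : 'M[F]_(_, _)) i j *:
                tens (vbasis {:U})`_i (vbasis {:V})`_j.
  rewrite [LHS](matrix_sum_delta (t : 'M[F]_(_, _))).
  apply: eq_bigr => i _; apply: eq_bigr => j _; congr (_ *: _).
  apply/matrixP => k l; rewrite !mxE.
  rewrite !coord_free ?(basis_free (vbasisP _)) //.
  by rewrite -natrM mulnb eq_sym [l == j]eq_sym.
rewrite !linear_sum; apply: eq_bigr => i _.
by rewrite !linear_sum; apply: eq_bigr => j _; rewrite !linearZ /= fg.
Qed.

Definition tmap U V U' V' (f : 'Hom(U, U')) (g : 'Hom(V, V')) :
    'Hom(tensor U V, tensor U' V') :=
  tlift (fun u v => tens (f u) (g v)).

Definition tswap U V : 'Hom(tensor U V, tensor V U) :=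
  tlift (fun u v => tens v u).

Definition tassoc U V W : 'Hom(tensor (tensor U V) W, tensor U (tensor V W)) :=
  tlift (fun t w => tlift (fun u v => tens u (tens v w)) t).

Definition tassocV U V W : 'Hom(tensor U (tensor V W), tensor (tensor U V) W) :=
  tlift (fun u t => tlift (fun v w => tens (tens u v) w) t).

Definition trot V : 'End(tensor V (tensor V V)) :=
  tlift (fun a t => tlift (fun b c => tens c (tens a b)) t).

Lemma tmapE U V U' V' (f : 'Hom(U, U')) (g : 'Hom(V, V')) u v :
  tmap f g (tens u v) = tens (f u) (g v).
Proof.
rewrite /tmap tlift_tens//; split=> [w k x y|w k x y] /=; rewrite linearP.
  exact: (tens_bilinear _ _).1.
exact: (tens_bilinear _ _).2.
Qed.

Lemma tswapE U V (u : U) (v : V) : tswap U V (tens u v) = tens v u.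
Proof.
rewrite /tswap tlift_tens//; split=> [w k x y|w k x y] /=.
  exact: (tens_bilinear _ _).2.
exact: (tens_bilinear _ _).1.
Qed.

(* f is trilinear; its lift is bilinear on X x (U (x) V). *)
Lemma tlift_param U V W X (f : X -> U -> V -> W) :
    (forall x, bilinear_for *:%R *:%R (f x)) ->
    (forall u v, linear (fun x => f x u v)) ->
  bilinear_for *:%R *:%R (fun x => tlift (f x)).
Proof.
move=> f2 f1; split=> [t k x y|x]; last exact: linearP.
have -> : tlift (f (k *: x + y)) = k *: tlift (f x) + tlift (f y).
  apply: tensor_ext => u v.
  by rewrite !lfunE /= !lfunE /= !tlift_tens//; exact: f1.
by rewrite !lfunE /= lfunE.
Qed.

Lemma tassocE U V W (u : U) (v : V) (w : W) :
  tassoc U V W (tens (tens u v) w) = tens u (tens v w).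
Proof.
have f2 z : bilinear_for *:%R *:%R (fun (x : U) (y : V) => tens x (tens y (z : W))).
  split=> [y k a b|x k a b] /=; first exact: (tens_bilinear _ _).1.
  by rewrite (tens_bilinear _ _).1 (tens_bilinear _ _).2.
have f1 x y : linear (fun z : W => tens (x : U) (tens (y : V) z)).
  by move=> k a b; rewrite (tens_bilinear _ _).2 (tens_bilinear _ _).2.
have [H1 H2] := tlift_param f2 f1.
rewrite /tassoc tlift_tens; first by rewrite (tlift_tens (f2 w)).
by split=> x; [exact: H2|exact: H1].
Qed.

Lemma tassocVE U V W (u : U) (v : V) (w : W) :
  tassocV U V W (tens u (tens v w)) = tens (tens u v) w.
Proof.
have f2 z : bilinear_for *:%R *:%R (fun (x : V) (y : W) => tens (tens (z : U) x) y).
  split=> [y k a b|x k a b] /=; last exact: (tens_bilinear _ _).2.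
  by rewrite (tens_bilinear _ _).2 (tens_bilinear _ _).1.
have f1 x y : linear (fun z : U => tens (tens z (x : V)) (y : W)).
  by move=> k a b; rewrite (tens_bilinear _ _).1 (tens_bilinear _ _).1.
rewrite /tassocV tlift_tens; first by rewrite (tlift_tens (f2 u)).
exact: tlift_param f2 f1.
Qed.

Lemma trotE V (a b c : V) : trot V (tens a (tens b c)) = tens c (tens a b).
Proof.
have f2 z : bilinear_for *:%R *:%R (fun x y : V => tens y (tens (z : V) x)).
  split=> [y k u v|x k u v] /=; last exact: (tens_bilinear _ _).1.
  by rewrite (tens_bilinear _ _).2 (tens_bilinear _ _).2.
have f1 x y : linear (fun z : V => tens (y : V) (tens z (x : V))).
  by move=> k u v; rewrite (tens_bilinear _ _).1 (tens_bilinear _ _).2.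
rewrite /trot tlift_tens; first by rewrite (tlift_tens (f2 a)).
exact: tlift_param f2 f1.
Qed.

End Tensor.

Section Structures.
Variables (F : fieldType) (A : vectType F).
Implicit Types (mul br ast : 'Hom(A, 'End(A))).
Implicit Types (Delta delta : 'Hom(A, tensor A A)).

Local Notation "f ⊗ g" := (tmap f g) (at level 40, left associativity).
Local Notation id := (\1%VF : 'End(A)).
Local Notation σ := (tswap A A).
Local Notation τ := (trot A).

Record comm_algebra mul : Prop := CommAlgebra {
  comm_algA : forall a b c, mul a (mul b c) = mul (mul a b) c;
  comm_algC : forall a b, mul a b = mul b a }.

Definition derivation mul (D : 'End(A)) : Prop :=
  forall a b, D (mul a b) = mul (D a) b + mul a (D b).

Definition commuting m (D : 'I_m -> 'End(A)) : Prop :=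
  forall k l, (D k \o D l = D l \o D k)%VF.

Definition zinbiel ast : Prop :=
  forall a b c, ast a (ast b c) = ast (ast a b) c + ast (ast b a) c.

Record diff_zinbiel m ast (D : 'I_m -> 'End(A)) : Prop := DiffZinbiel {
  dz_zinbiel : zinbiel ast;
  dz_commuting : commuting D;
  dz_derivation : forall k, derivation ast (D k) }.

Record cocomm_coalgebra Delta : Prop := CocommCoalgebra {
  cocomm_coalgA : forall a,
    tassoc A A A ((Delta ⊗ id) (Delta a)) = (id ⊗ Delta) (Delta a);
  cocomm_coalgC : forall a, σ (Delta a) = Delta a }.

Record comm_cocomm_asi mul Delta : Prop := CommCocommAsi {
  asi_alg : comm_algebra mul;
  asi_coalg : cocomm_coalgebra Delta;
  asi_mul : forall a b,
    Delta (mul a b) = (mul b ⊗ id) (Delta a) + (id ⊗ mul a) (Delta b);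
  asi_sym : forall a b,
    (mul a ⊗ id - id ⊗ mul a) (Delta b)
      = σ ((id ⊗ mul b - mul b ⊗ id) (Delta a)) }.

Record comm_cocomm_diff_asi m mul Delta (D E : 'I_m -> 'End(A)) : Prop :=
  CommCocommDiffAsi {
  dasi_asi : comm_cocomm_asi mul Delta;
  dasi_commD : commuting D;
  dasi_derD : forall k, derivation mul (D k);
  dasi_commE : commuting E;
  dasi_coderE : forall k a, Delta (E k a) = (E k ⊗ id + id ⊗ E k) (Delta a);
  dasi_mull : forall k a b, mul (E k a) b = mul a (D k b) + E k (mul a b);
  dasi_mulr : forall k a b, mul a (E k b) = mul (D k a) b + E k (mul a b);
  dasi_Deltal : forall k a,
    (D k ⊗ id) (Delta a) = (id ⊗ E k) (Delta a) + Delta (D k a);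
  dasi_Deltar : forall k a,
    (id ⊗ D k) (Delta a) = (E k ⊗ id) (Delta a) + Delta (D k a) }.

Record lie_algebra br : Prop := LieAlgebra {
  lie_alt : forall a, br a a = 0;
  lie_jacobi : forall a b c,
    br a (br b c) + br b (br c a) + br c (br a b) = 0 }.

Record poisson_algebra br mul : Prop := PoissonAlgebra {
  pa_lie : lie_algebra br;
  pa_alg : comm_algebra mul;
  pa_leibniz : forall a b c, br a (mul b c) = mul (br a b) c + mul b (br a c) }.

Record poisson_coalgebra delta Delta : Prop := PoissonCoalgebra {
  pc_anti : forall a, delta a = - σ (delta a);
  pc_jacobi : forall a,
    (\1 + τ + (τ \o τ))%VF ((id ⊗ delta) (delta a)) = 0;
  pc_coalg : cocomm_coalgebra Delta;
  pc_leibniz : forall a,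
    (id ⊗ Delta) (delta a)
      = tassoc A A A ((delta ⊗ id) (Delta a))
        + tassoc A A A
            ((σ ⊗ id) (tassocV A A A ((id ⊗ delta) (Delta a)))) }.

Record poisson_bialgebra br mul delta Delta : Prop := PoissonBialgebra {
  pb_alg : poisson_algebra br mul;
  pb_coalg : poisson_coalgebra delta Delta;
  pb_asi : comm_cocomm_asi mul Delta;
  pb_lie : forall a b,
    delta (br a b) = (br a ⊗ id + id ⊗ br a) (delta b)
                     - (br b ⊗ id + id ⊗ br b) (delta a);
  pb_delta_mul : forall a b,
    delta (mul a b) = (mul a ⊗ id) (delta b) + (mul b ⊗ id) (delta a)
                      + (id ⊗ br a) (Delta b) + (id ⊗ br b) (Delta a);
  pb_Delta_br : forall a b,
    Delta (br a b) = (br a ⊗ id + id ⊗ br a) (Delta b)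
                     + (mul b ⊗ id - id ⊗ mul b) (delta a) }.

(* For families indexed by 'I_2, D 0 and D 1 stand for d_1 and d_2.
   With m the commutative product this is the induced Poisson bracket; with m
   the Zinbiel product it is the induced pre-Poisson operation. *)
Definition wronskian (m : 'Hom(A, 'End(A))) (D : 'I_2 -> 'End(A)) :
    'Hom(A, 'End(A)) :=
  bifun (fun a b => m (D 0 a) (D 1 b) - m (D 1 a) (D 0 b)).

Lemma wronskianE (m : 'Hom(A, 'End(A))) (D : 'I_2 -> 'End(A)) a b :
  wronskian m D a b = m (D 0 a) (D 1 b) - m (D 1 a) (D 0 b).
Proof.
rewrite /wronskian bifunE//; split=> [w k x y|w k x y] /=.
  rewrite !(linearP (D _)) !(linearP m) !add_lfunE !scale_lfunE.
  by rewrite opprD addrACA -scalerBr.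
rewrite !(linearP (D _)) !(linearP (m _)) /=.
by rewrite opprD addrACA -scalerBr.
Qed.

Definition zinbiel_comm ast : 'Hom(A, 'End(A)) :=
  bifun (fun a b => ast a b + ast b a).

Lemma zinbiel_commE ast a b : zinbiel_comm ast a b = ast a b + ast b a.
Proof.
rewrite /zinbiel_comm bifunE//; split=> [w k x y|w k x y] /=;
by rewrite !(linearP ast) !(linearP (ast _)) !add_lfunE !scale_lfunE /=
           addrACA -scalerDr.
Qed.

Record induces_poisson_bialgebra mul Delta (D E : 'I_2 -> 'End(A)) br delta :
    Prop := InducesPoissonBialgebra {
  ipb_mul : forall a b, mul (E 1 (D 0 a)) b = mul (E 0 (D 1 a)) b;
  ipb_Delta : forall a,
    ((E 1 \o D 0)%VF ⊗ id) (Delta a) = ((E 0 \o D 1)%VF ⊗ id) (Delta a);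
  ipb_br : br = wronskian mul D;
  ipb_delta : forall a, delta a = (E 0 ⊗ E 1 - E 1 ⊗ E 0) (Delta a) }.

Definition cobr br (r : tensor A A) : 'Hom(A, tensor A A) :=
  lin (fun x => (id ⊗ br x + br x ⊗ id) r).

Definition comul mul (r : tensor A A) : 'Hom(A, tensor A A) :=
  lin (fun x => (id ⊗ mul x - mul x ⊗ id) r).

Lemma tmap_lin (f g h : 'End(A)) k :
  (h ⊗ (k *: f + g) = k *: (h ⊗ f) + h ⊗ g) *
  ((k *: f + g) ⊗ h = k *: (f ⊗ h) + g ⊗ h).
Proof.
by split; apply: tensor_ext => u v;
   rewrite !(add_lfunE, scale_lfunE, tmapE) (tens_bilinear _ _).
Qed.

Lemma cobrE br r x : cobr br r x = (id ⊗ br x + br x ⊗ id) r.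
Proof.
rewrite /cobr linE// => k a b; rewrite linearP !tmap_lin.
by rewrite addrACA -scalerDr [LHS]add_lfunE [in LHS]scale_lfunE.
Qed.

Lemma comulE mul r x : comul mul r x = (id ⊗ mul x - mul x ⊗ id) r.
Proof.
rewrite /comul linE// => k a b; rewrite linearP !tmap_lin.
by rewrite opprD addrACA -scalerBr [LHS]add_lfunE [in LHS]scale_lfunE.
Qed.

End Structures.

(* Operations on A (+) V; the element (a, v) stands for a + v. *)
Section SemiDirect.
Variables (F : fieldType) (A V : vectType F).
Implicit Types (mul br : 'Hom(A, 'End(A))) (mu rho : 'Hom(A, 'End(V))).
Local Notation hat := (A * V)%type.

Definition sd_mul mul mu : 'Hom(hat, 'End(hat)) :=
  bifun (fun x y : hat => (mul x.1 y.1, mu x.1 y.2 + mu y.1 x.2)).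

Definition sd_br br rho : 'Hom(hat, 'End(hat)) :=
  bifun (fun x y : hat => (br x.1 y.1, rho x.1 y.2 - rho y.1 x.2)).

Definition sd_end (f : 'End(A)) (g : 'End(V)) : 'End(hat) :=
  lin (fun x : hat => (f x.1, g x.2)).

Lemma sd_mulE mul mu x y :
  sd_mul mul mu x y = (mul x.1 y.1, mu x.1 y.2 + mu y.1 x.2).
Proof.
rewrite /sd_mul bifunE//; split=> w k u v /=;
rewrite ?(linearP mul) ?(linearP mu) ?(linearP (mul _)) ?(linearP (mu _)) /=;
rewrite ?(add_lfunE, scale_lfunE); congr (_, _);
by rewrite addrACA -scalerDr.
Qed.

Lemma sd_brE br rho x y :
  sd_br br rho x y = (br x.1 y.1, rho x.1 y.2 - rho y.1 x.2).
Proof.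
rewrite /sd_br bifunE//; split=> w k u v /=;
rewrite ?(linearP br) ?(linearP rho) ?(linearP (br _)) ?(linearP (rho _)) /=;
rewrite ?(add_lfunE, scale_lfunE); congr (_, _);
by rewrite opprD addrACA -scalerBr.
Qed.

Lemma sd_endE f g x : sd_end f g x = (f x.1, g x.2).
Proof. by rewrite /sd_end linE// => k u v; rewrite /= !linearP. Qed.

End SemiDirect.

(* sum_i (e_i (x) e_i^* - e_i^* (x) e_i) in (A (+) A^* ) (x) (A (+) A^* ) *)
Definition dual_r (F : fieldType) (A : vectType F) n (e : n.-tuple A)
    (es : n.-tuple (dual A)) : tensor (A * dual A)%type (A * dual A)%type :=
  \sum_(i < n) (tens (tnth e i, 0) (0, tnth es i)
                - tens (0, tnth es i) (tnth e i, 0)).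

(* Main.v *)
Require Import Defs.
From mathcomp Require Import all_boot all_algebra.
From mathcomp Require Import ring.

Set Implicit Arguments.
Unset Strict Implicit.
Unset Printing Implicit Defensive.

Import GRing.Theory.
Local Open Scope ring_scope.

(** The notion that makes the whole statement routine is a skew-symmetric
    form. On P = A (+) A^*, let omega (a + u, b + v) = v(a) - u(b).  It is
    nondegenerate, and r is its Casimir element: (phi (x) omega z) r = phi z
    for every functional phi ([dual_r_casimir]).  The Zinbiel structure enters
    only through the following facts about P: the product is commutative and
    associative ([double_comm_algebra]), omega is a Connes cocycle for it,
      omega(xy, z) + omega(yz, x) + omega(zx, y) = 0   ([double_connes]),
    and the maps D_k = d_k - d_k^* are commuting derivations that are skew for
    omega ([double_derivation], [double_end_skew]).  Furthermore the bracket
    of P is the Wronskian D_1 x D_2 y - D_2 x D_1 y ([double_wronskian]),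
    hence a Poisson bracket ([wronskian_poisson]), and omega is a cyclic
    cocycle for the bracket as well ([wronskian_cocycle]).

    From there A can be forgotten.  Reading tensors through omega, the cocycle
    identities turn the coboundary definitions of Delta and delta into
      (omega y (x) omega z)(Delta x) = omega(x, yz),
      (omega y (x) omega z)(delta x) = omega(x, [y, z])
    ([comul_dualizes], [cobr_dualizes]): up to the identification of P with
    its dual, Delta and delta are the transposes of the product and of the
    bracket. The coalgebra axioms are therefore the transposes of the algebra
    axioms.  For the compatibility conditions, let S x and T x be the omega-
    adjoints of the product and of the bracket by x.  The cocycle identities
    say exactly that
      S x z + S z x = xz   and   T x z - T z x = - [x, z],
    i.e. that S and - T form a pre-Poisson structure splitting the Poisson
    one; with these rules every compatibility condition, evaluated at omega z
    (x) omega w, reduces to associativity, the Leibniz rule or the Jacobi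
    identity ([dual_asi], [dual_poisson_bialgebra]).  Since D_k is skew, the
    adjoint of D_k is - D_k = E_k, which gives the differential part
    ([dual_diff_asi], [dual_induces_poisson]). *)

(** * Evaluation of linear and bilinear maps *)

Section Linearity.
Variable F : fieldType.
Implicit Types U V W : vectType F.

Lemma bilDl U V W (f : 'Hom(U, 'Hom(V, W))) x y z :
  f (x + y) z = f x z + f y z.
Proof. by rewrite linearD add_lfunE. Qed.

Lemma bilBl U V W (f : 'Hom(U, 'Hom(V, W))) x y z :
  f (x - y) z = f x z - f y z.
Proof. by rewrite linearB add_lfunE opp_lfunE. Qed.

Lemma bilNl U V W (f : 'Hom(U, 'Hom(V, W))) x z : f (- x) z = - f x z.
Proof. by rewrite linearN opp_lfunE. Qed.

Lemma evD V (phi psi : dual V) v : ev (phi + psi) v = ev phi v + ev psi v.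
Proof. by rewrite /ev add_lfunE. Qed.

Lemma evB V (phi psi : dual V) v : ev (phi - psi) v = ev phi v - ev psi v.
Proof. by rewrite /ev add_lfunE opp_lfunE. Qed.

Lemma evN V (phi : dual V) v : ev (- phi) v = - ev phi v.
Proof. by rewrite /ev opp_lfunE. Qed.

Lemma evDr V (phi : dual V) v w : ev phi (v + w) = ev phi v + ev phi w.
Proof. by rewrite /ev linearD. Qed.

Lemma evBr V (phi : dual V) v w : ev phi (v - w) = ev phi v - ev phi w.
Proof. by rewrite /ev linearB. Qed.

Lemma evNr V (phi : dual V) v : ev phi (- v) = - ev phi v.
Proof. by rewrite /ev linearN. Qed.

Lemma ev0 V (v : V) : ev (0 : dual V) v = 0.
Proof. by rewrite /ev zero_lfunE. Qed.

Lemma ev0r V (phi : dual V) : ev phi 0 = 0.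
Proof. by rewrite /ev linear0. Qed.

Definition evE := (evD, evB, evN, ev0, evDr, evBr, evNr, ev0r).

Lemma ev_sum V (phi : dual V) I (s : seq I) (v : I -> V) :
  ev phi (\sum_(i <- s) v i) = \sum_(i <- s) ev phi (v i).
Proof. by rewrite /ev linear_sum. Qed.

End Linearity.

(** * Functionals on tensor products *)

Section TensorPairing.
Variable F : fieldType.
Implicit Types U V W X : vectType F.

Definition tpair U V (phi : dual U) (psi : dual V) : dual (tensor U V) :=
  tlift (fun u v => ev phi u * ev psi v : F^o).

Definition contract U V (phi : dual U) : 'Hom(tensor U V, V) :=
  tlift (fun u v => ev phi u *: v).

Lemma tpairE U V (phi : dual U) (psi : dual V) u v :
  ev (tpair phi psi) (tens u v) = ev phi u * ev psi v.
Proof.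
rewrite /ev /tpair tlift_tens//; split=> [w k x y|w k x y] /=.
  by rewrite (ev_linear phi) mulrDl scalerAl.
by rewrite (ev_linear psi) mulrDr scalerAr.
Qed.

Lemma contractE U V (phi : dual U) u (v : V) :
  contract V phi (tens u v) = ev phi u *: v.
Proof.
rewrite /contract tlift_tens//; split=> [w k x y|w k x y] /=.
  by rewrite (ev_linear phi) scalerDl scalerA.
by rewrite scalerDr !scalerA mulrC.
Qed.

(** Contraction evaluates a tensor one factor at a time, which is what lets
    statements about functionals pass to iterated tensor products. *)
Lemma ev_contract U V (phi : dual U) (psi : dual V) t :
  ev psi (contract V phi t) = ev (tpair phi psi) t.
Proof.
suff : (psi \o contract V phi)%VF = tpair phi psi :> dual _.
  by move=> <-; rewrite /ev comp_lfunE.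
apply: tensor_ext => u v; rewrite comp_lfunE contractE -/(ev _ _) -/(ev _ _).
by rewrite tpairE /ev linearZ.
Qed.

Lemma tpair_swap U V (phi : dual U) (psi : dual V) t :
  ev (tpair phi psi) (tswap V U t) = ev (tpair psi phi) t.
Proof.
suff : (tpair phi psi \o tswap V U)%VF = tpair psi phi :> dual _.
  by move=> <-; rewrite /ev comp_lfunE.
apply: tensor_ext => u v; rewrite comp_lfunE tswapE -/(ev _ _) -/(ev _ _).
by rewrite !tpairE mulrC.
Qed.

Lemma tpairNr U V (phi : dual U) (psi : dual V) t :
  ev (tpair phi (- psi)) t = - ev (tpair phi psi) t.
Proof. by rewrite -!ev_contract evN. Qed.

Lemma tpairNl U V (phi : dual U) (psi : dual V) t :
  ev (tpair (- phi) psi) t = - ev (tpair phi psi) t.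
Proof. by rewrite -tpair_swap tpairNr tpair_swap. Qed.

Lemma tpair_map U V U' V' (f : 'Hom(U, U')) (g : 'Hom(V, V')) phi psi t :
  ev (tpair phi psi) (tmap f g t) = ev (tpair (transp f phi) (transp g psi)) t.
Proof.
suff : (tpair phi psi \o tmap f g)%VF
         = tpair (transp f phi) (transp g psi) :> dual _.
  by move=> <-; rewrite /ev comp_lfunE.
apply: tensor_ext => u v; rewrite comp_lfunE tmapE -/(ev _ _) -/(ev _ _).
by rewrite !tpairE !transpE.
Qed.

Lemma transp_id V (phi : dual V) : transp \1%VF phi = phi.
Proof. by apply: dual_ext => v; rewrite transpE id_lfunE. Qed.

(** Fixing one factor reduces equality of linear maps on a triple tensor
    product to equality on a double one. *)
Lemma tensor3_extr U V W X (f g : 'Hom(tensor U (tensor V W), X)) :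
  (forall u v w, f (tens u (tens v w)) = g (tens u (tens v w))) -> f = g.
Proof.
move=> fg; apply: tensor_ext => u t.
suff : (f \o lin (fun t => tens u t) = g \o lin (fun t => tens u t))%VF.
  by move/lfunP/(_ t); rewrite !comp_lfunE linE//; exact: (tens_bilinear _ _).2.
apply: tensor_ext => v w; rewrite !comp_lfunE linE ?fg//.
exact: (tens_bilinear _ _).2.
Qed.

Lemma tensor3_extl U V W X (f g : 'Hom(tensor (tensor U V) W, X)) :
  (forall u v w, f (tens (tens u v) w) = g (tens (tens u v) w)) -> f = g.
Proof.
move=> fg; apply: tensor_ext => t w.
suff : (f \o lin (fun t => tens t w) = g \o lin (fun t => tens t w))%VF.
  by move/lfunP/(_ t); rewrite !comp_lfunE linE//; exact: (tens_bilinear _ _).1.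
apply: tensor_ext => u v; rewrite !comp_lfunE linE ?fg//.
exact: (tens_bilinear _ _).1.
Qed.

Lemma tpair_assoc U V W (phi : dual U) (psi : dual V) (chi : dual W) t :
  ev (tpair phi (tpair psi chi)) (tassoc U V W t)
    = ev (tpair (tpair phi psi) chi) t.
Proof.
suff : (tpair phi (tpair psi chi) \o tassoc U V W)%VF
         = tpair (tpair phi psi) chi :> dual _.
  by move=> <-; rewrite /ev comp_lfunE.
apply: tensor3_extl => u v w; rewrite comp_lfunE tassocE -/(ev _ _) -/(ev _ _).
by rewrite !tpairE mulrA.
Qed.

Lemma tpair_assocV U V W (phi : dual U) (psi : dual V) (chi : dual W) t :
  ev (tpair (tpair phi psi) chi) (tassocV U V W t)
    = ev (tpair phi (tpair psi chi)) t.
Proof.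
suff : (tpair (tpair phi psi) chi \o tassocV U V W)%VF
         = tpair phi (tpair psi chi) :> dual _.
  by move=> <-; rewrite /ev comp_lfunE.
apply: tensor3_extr => u v w; rewrite comp_lfunE tassocVE -/(ev _ _) -/(ev _ _).
by rewrite !tpairE mulrA.
Qed.

Lemma tpair_rot V (phi psi chi : dual V) t :
  ev (tpair phi (tpair psi chi)) (trot V t)
    = ev (tpair psi (tpair chi phi)) t.
Proof.
suff : (tpair phi (tpair psi chi) \o trot V)%VF
         = tpair psi (tpair chi phi) :> dual _.
  by move=> <-; rewrite /ev comp_lfunE.
apply: tensor3_extr => u v w; rewrite comp_lfunE trotE -/(ev _ _) -/(ev _ _).
by rewrite !tpairE; ring.
Qed.

Lemma ev_inj V (v w : V) : (forall phi : dual V, ev phi v = ev phi w) -> v = w.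
Proof.
move=> E; rewrite (coord_vbasis (memvf v)) (coord_vbasis (memvf w)).
apply: eq_bigr => i _; congr (_ *: _).
have L : linear (coord (vbasis {:V}) i : V -> F^o).
  by move=> k x y; rewrite linearP.
by have := E (lin (coord (vbasis {:V}) i : V -> F^o)); rewrite /ev !linE.
Qed.

Lemma tpair_inj U V (t t' : tensor U V) :
    (forall (phi : dual U) (psi : dual V),
       ev (tpair phi psi) t = ev (tpair phi psi) t') ->
  t = t'.
Proof.
move=> E; apply/matrixP => i j.
have C W k : linear (coord (vbasis {:W}) k : W -> F^o).
  by move=> a x y; rewrite linearP.
pose c W k : dual W := lin (coord (vbasis {:W}) k : W -> F^o).
suff P s : ev (tpair (c U i) (c V j)) s = (s : 'M[F]_(_, _)) i j.
  by rewrite -!P E.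
have L : linear (fun s : tensor U V => (s : 'M[F]_(_, _)) i j : F^o).
  by move=> a x y; rewrite !mxE.
suff -> : tpair (c U i) (c V j)
            = lin (fun s : tensor U V => (s : 'M[F]_(_, _)) i j : F^o).
  by rewrite /ev linE.
apply: tensor_ext => u v; rewrite (linE L) -/(ev _ _) tpairE mxE.
by rewrite /c /ev !linE.
Qed.

(** Contracting the first factor leaves a double tensor, which is determined
    by its pairings. *)
Lemma tpair3_inj U V W (t t' : tensor U (tensor V W)) :
    (forall (phi : dual U) (psi : dual V) (chi : dual W),
       ev (tpair phi (tpair psi chi)) t = ev (tpair phi (tpair psi chi)) t') ->
  t = t'.
Proof.
move=> E; apply: tpair_inj => phi psi; rewrite -!ev_contract; congr (ev psi _).
by apply: tpair_inj => psi' chi; rewrite !ev_contract.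
Qed.

End TensorPairing.

(** * Commutative, Lie and Wronskian identities *)

Lemma comm_algCA (F : fieldType) (P : vectType F) (mul : 'Hom(P, 'End(P))) :
  comm_algebra mul -> forall x y z, mul x (mul y z) = mul y (mul x z).
Proof. by case=> mulA mulC x y z; rewrite mulA (mulC x) -mulA. Qed.

Section Lie.
Variables (F : fieldType) (P : vectType F) (br : 'Hom(P, 'End(P))).
Hypothesis brP : lie_algebra br.

Lemma lie_brC x y : br x y = - br y x.
Proof.
have /eqP := lie_alt brP (x + y).
rewrite bilDl !linearD /= !(lie_alt brP) add0r addr0.
by rewrite addr_eq0 => /eqP.
Qed.

Lemma lie_jacobiE x z w : br x (br z w) = br w (br z x) - br z (br w x).
Proof.
have /eqP := lie_jacobi brP x z w; rewrite (lie_brC x z) linearN -addrA.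
by rewrite addr_eq0 opprB => /eqP ->; rewrite addrC.
Qed.

End Lie.

Lemma commutingE (F : fieldType) (V : vectType F) m (D : 'I_m -> 'End(V)) :
  commuting D -> forall k l x, D k (D l x) = D l (D k x).
Proof. by move=> D_comm k l x; rewrite -!comp_lfunE D_comm. Qed.

Section Wronskian.
Variables (F : fieldType) (P : vectType F).
Variables (mul : 'Hom(P, 'End(P))) (D : 'I_2 -> 'End(P)).
Hypothesis mulP : comm_algebra mul.
Hypothesis D_comm : commuting D.
Hypothesis D_der : forall k, derivation mul (D k).

Let mulA := comm_algA mulP.
Let mulC := comm_algC mulP.
Local Notation br := (wronskian mul D).

Let mul3 x y z := mul x (mul y z).

Let mul3_rot x y z : mul3 x y z = mul3 z x y.
Proof. by rewrite /mul3 mulA mulC. Qed.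

(* Every factor keeps its place: first a, then b, then c.  The three cyclic
   instances then differ by rotations of mul3 only. *)
Let wronskian2E a b c :
  br a (br b c) =
    mul3 (D 0 a) (D 0 (D 1 b)) (D 1 c) + mul3 (D 0 a) (D 0 b) (D 1 (D 1 c))
    - mul3 (D 0 a) (D 1 (D 1 b)) (D 0 c) - mul3 (D 0 a) (D 1 b) (D 0 (D 1 c))
    - mul3 (D 1 a) (D 0 (D 0 b)) (D 1 c) - mul3 (D 1 a) (D 0 b) (D 0 (D 1 c))
    + mul3 (D 1 a) (D 0 (D 1 b)) (D 0 c) + mul3 (D 1 a) (D 1 b) (D 0 (D 0 c)).
Proof.
rewrite !wronskianE !linearB /= !D_der !(commutingE D_comm 1 0) !linearD /=.
by apply: ev_inj => phi; rewrite !evE /mul3; ring.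
Qed.

(** In the Jacobi identity each of the twelve products, such as D_1 a D_1 D_2
    b D_2 c, occurs twice with opposite signs, because the derivations
    commute. *)
Lemma wronskian_poisson : poisson_algebra br mul.
Proof.
split=> [|//|a b c].
  split=> [a|a b c]; first by rewrite wronskianE mulC subrr.
  (* Functionals turn the identity into one that the ring tactic decides. *)
  apply: ev_inj => phi; rewrite !wronskian2E !(mul3_rot (D _ b)).
  by rewrite -!(mul3_rot _ _ (D _ c)) !evE; ring.
rewrite !wronskianE !D_der bilBl linearB !linearD /= -!mulA.
rewrite !(comm_algCA mulP b).
by apply: ev_inj => phi; rewrite !evE; ring.
Qed.

End Wronskian.

(** * Nondegenerate skew forms and their Casimir element *)

Section SkewForm.
Variables (F : fieldType) (P : vectType F).
Variables (om : 'Hom(P, dual P)) (r : tensor P P).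

Hypothesis om_skew : forall x y, ev (om x) y = - ev (om y) x.
Hypothesis casimir : forall (phi : dual P) z,
  ev (tpair phi (om z)) r = ev phi z.

Implicit Types (f g : 'End(P)) (x y z w : P).

(** The inverse of om.  Its existence is how the Casimir element witnesses
    that the form is nondegenerate; the sign comes from contracting the first
    factor. *)
Definition sharp (phi : dual P) : P := - contract P phi r.

Lemma om_sharp phi : om (sharp phi) = phi.
Proof.
apply: dual_ext => z; rewrite om_skew /sharp evNr opprK ev_contract.
exact: casimir.
Qed.

Lemma om_inj x y : (forall z, ev (om x) z = ev (om y) z) -> x = y.
Proof.
move=> E; apply: ev_inj => phi; rewrite -(om_sharp phi).
by rewrite [LHS]om_skew [RHS]om_skew E.
Qed.

Definition adj f z : P := sharp (transp f (om z)).

Lemma om_adj f z : om (adj f z) = transp f (om z).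
Proof. exact: om_sharp. Qed.

Lemma om_adjl f z x : ev (om (adj f z)) x = ev (om z) (f x).
Proof. by rewrite om_adj transpE. Qed.

Definition opair y z : dual (tensor P P) := tpair (om y) (om z).

Lemma opair_inj (t t' : tensor P P) :
  (forall y z, ev (opair y z) t = ev (opair y z) t') -> t = t'.
Proof.
move=> E; apply: tpair_inj => phi psi.
by rewrite -(om_sharp phi) -(om_sharp psi); exact: E.
Qed.

Lemma opair3_inj (t t' : tensor P (tensor P P)) :
    (forall x y z, ev (tpair (om x) (opair y z)) t
                   = ev (tpair (om x) (opair y z)) t') ->
  t = t'.
Proof.
move=> E; apply: tpair3_inj => phi psi chi.
by rewrite -(om_sharp phi) -(om_sharp psi) -(om_sharp chi); exact: E.
Qed.

Lemma opair_casimirl f y z : ev (opair y z) (tmap f \1%VF r) = ev (om y) (f z).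
Proof. by rewrite tpair_map transp_id casimir transpE. Qed.

Lemma opair_casimirr f y z :
  ev (opair y z) (tmap \1%VF f r) = - ev (om z) (f y).
Proof. by rewrite tpair_map transp_id -om_adj casimir om_skew om_adjl. Qed.

Lemma opair_map f g y z t :
  ev (opair y z) (tmap f g t) = ev (opair (adj f y) (adj g z)) t.
Proof. by rewrite tpair_map -!om_adj. Qed.

Lemma opair_mapl f y z t :
  ev (opair y z) (tmap f \1%VF t) = ev (opair (adj f y) z) t.
Proof. by rewrite tpair_map transp_id -om_adj. Qed.

Lemma opair_mapr f y z t :
  ev (opair y z) (tmap \1%VF f t) = ev (opair y (adj f z)) t.
Proof. by rewrite tpair_map transp_id -om_adj. Qed.

Lemma opair_swap y z t : ev (opair y z) (tswap P P t) = ev (opair z y) t.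
Proof. exact: tpair_swap. Qed.

(** Through the identification of P with its dual given by om, Delta is the
    transpose of m, up to sign. *)
Definition dualizes (Delta : 'Hom(P, tensor P P)) (m : 'Hom(P, 'End(P))) :
    Prop :=
  forall x y z, ev (opair y z) (Delta x) = ev (om x) (m y z).

Section Dualizes.
Variables (Delta : 'Hom(P, tensor P P)) (m : 'Hom(P, 'End(P))).
Hypothesis Dm : dualizes Delta m.

(** The sign comes from moving x to the second argument of the skew form.  It
    occurs once for each comultiplication after the first one, hence equally
    often in all terms of a coalgebra axiom. *)
Lemma transp_dualizes y z : transp Delta (opair y z) = - om (m y z).
Proof. by apply: dual_ext => x; rewrite transpE Dm evN -om_skew. Qed.

Lemma opair_comulr x y z t :
  ev (tpair (om x) (opair y z)) (tmap \1%VF Delta t) = - ev (opair x (m y z)) t.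
Proof. by rewrite tpair_map transp_id transp_dualizes tpairNr. Qed.

Lemma opair_comull x y z t :
  ev (tpair (opair x y) (om z)) (tmap Delta \1%VF t) = - ev (opair (m x y) z) t.
Proof. by rewrite tpair_map transp_id transp_dualizes tpairNl. Qed.

End Dualizes.

Local Notation ω x y := (ev (om x) y).

(** Moving g, then f, to the other side of the form exchanges the two
    arguments. This is the one rule for nested adjoints in the compatibility
    conditions. *)
Lemma adj_swap f g x y : ω y (f (adj g x)) = - ω x (g (adj f y)).
Proof. by rewrite -[LHS]om_adjl om_skew om_adjl. Qed.

(** For a commutative product m this is a Connes cocycle, for a Lie bracket m
    a 2-cocycle. *)
Definition cyclic_cocycle (m : 'Hom(P, 'End(P))) : Prop :=
  forall x y z, ω (m x y) z + ω (m y z) x + ω (m z x) y = 0.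

(** * The ASI bialgebra of a Connes cocycle *)

Section ConnesCocycle.
Variable mul : 'Hom(P, 'End(P)).
Local Notation S x z := (adj (mul x) z).
Hypothesis mulP : comm_algebra mul.
Hypothesis mul_cocycle : cyclic_cocycle mul.

Let mulA := comm_algA mulP.
Let mulC := comm_algC mulP.

(** The Connes cocycle condition, paired with w.  With associativity it makes
    S a Zinbiel product whose symmetrization is mul. *)
Lemma adj_mulE x z : S x z = mul x z - S z x.
Proof.
apply: om_inj => w; rewrite linearB evB !om_adjl.
apply/eqP; rewrite -subr_eq0; apply/eqP.
rewrite -[RHS]oppr0 -(mul_cocycle x z w).
by rewrite (mulC w x) [ω (mul z w) x]om_skew [ω (mul x w) z]om_skew; ring.
Qed.

Lemma om_mul x y t : ω (mul x y) t = ω y (mul x t) + ω x (mul y t).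
Proof. by rewrite -!om_adjl -evD -linearD adj_mulE subrK. Qed.

(** Since r is the Casimir element, Delta x pairs with y and z to - om z (xy)
    - om y (xz), which the cocycle condition rewrites as om x (yz). *)
Lemma comul_dualizes : dualizes (comul mul r) mul.
Proof.
move=> x y z; rewrite comulE add_lfunE opp_lfunE evBr.
rewrite opair_casimirr opair_casimirl.
by rewrite [RHS]om_skew om_mul (mulC y) (mulC z); ring.
Qed.

(** Brings the terms produced by the two legs of a tensor to a common shape,
    in which S z y and S y z add up to a product. *)
Lemma mul_adj_swap x y z w :
  ω y (mul z (S x w)) = ω x (mul w (S z y)) + ω y (mul z (mul x w)).
Proof. by rewrite adj_mulE linearB evBr (adj_swap _ (mul w)); ring. Qed.

Section Comul.
Variable Delta : 'Hom(P, tensor P P).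
Hypothesis Dm : dualizes Delta mul.

Lemma dual_coalgebra : cocomm_coalgebra Delta.
Proof.
split=> a.
  apply: opair3_inj => x y z; rewrite tpair_assoc (opair_comulr Dm).
  by rewrite (opair_comull Dm) !Dm mulA.
by apply: opair_inj => y z; rewrite opair_swap !Dm mulC.
Qed.

(** After [mul_adj_swap] the adjoints in each condition combine by [adj_mulE],
    and only products of three elements remain. *)
Lemma dual_asi : comm_cocomm_asi mul Delta.
Proof.
split=> [||x y|x y]; [exact: mulP|exact: dual_coalgebra| |];
  apply: opair_inj => z w.
- rewrite evDr opair_mapl opair_mapr !Dm (mul_adj_swap x y z w).
  rewrite (mulC (S y z) w) om_mul.
  rewrite (adj_mulE y z) linearB evBr (mulC z w) (comm_algCA mulP y w z).
  by rewrite (mulC w z) (comm_algCA mulP x z w); ring.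
- rewrite opair_swap !add_lfunE !opp_lfunE !evBr !opair_mapl !opair_mapr !Dm.
  rewrite (mulC (S x z)) (mulC (S y w)).
  rewrite (mul_adj_swap x y z w) (mul_adj_swap y x z w).
  rewrite (adj_mulE x z) (adj_mulE y z) !linearB !evBr.
  rewrite /= (mulC x w) (mulC y w) !(comm_algCA mulP z w).
  by rewrite (mulC z x) (mulC z y); ring.
Qed.

End Comul.

(** * The Poisson bialgebra of a Poisson algebra with two cocycle conditions *)

Section Poisson.
Variable br : 'Hom(P, 'End(P)).
Local Notation T x z := (adj (br x) z).
Hypothesis brP : poisson_algebra br mul.
Hypothesis br_cocycle : cyclic_cocycle br.

Let brC := lie_brC (pa_lie brP).
Let jacobi := lie_jacobi (pa_lie brP).
Let jacobiE := lie_jacobiE (pa_lie brP).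
Let leibniz := pa_leibniz brP.

(** The 2-cocycle condition, paired with w.  With the Jacobi identity it makes
    - T a pre-Lie product whose commutator is br. *)
Lemma adj_brE x z : T x z = T z x + br z x.
Proof.
apply: om_inj => w; rewrite linearD evD !om_adjl.
apply/eqP; rewrite -subr_eq0; apply/eqP.
rewrite -[RHS]oppr0 -(br_cocycle z x w).
rewrite (brC w z) linearN evN.
by rewrite [ω (br x w) z]om_skew [ω (br z w) x]om_skew; ring.
Qed.

Lemma om_br x y t : ω (br x y) t = ω x (br y t) - ω y (br x t).
Proof.
rewrite -!om_adjl [T y x]adj_brE [in RHS]linearD evD; ring.
Qed.

Lemma cobr_dualizes : dualizes (cobr br r) br.
Proof.
move=> x y z; rewrite cobrE add_lfunE evDr opair_casimirr opair_casimirl.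
rewrite [RHS]om_skew om_br [br y x]brC [br z x]brC.
by rewrite !evNr (brC x z) (brC x y) !evNr; ring.
Qed.

(** The bracket counterpart of [mul_adj_swap]; it serves for multiplications
    and adjoint actions f. *)
Lemma br_adj_swap f x y w :
  ω y (f (T x w)) = - ω x (br w (adj f y)) + ω y (f (br w x)).
Proof. by rewrite adj_brE linearD evDr (adj_swap _ (br w)). Qed.

Variables delta Delta : 'Hom(P, tensor P P).
Hypotheses (dm : dualizes delta br) (Dm : dualizes Delta mul).

(** Each axiom is the transpose of an axiom of the Poisson algebra:
    antisymmetry, Jacobi, associativity and commutativity, Leibniz. *)
Lemma dual_poisson_coalgebra : poisson_coalgebra delta Delta.
Proof.
split=> [a|a||a]; last 2 first.
- exact: dual_coalgebra.
- apply: opair3_inj => x y z; rewrite evDr !tpair_assoc (opair_comulr Dm) dm.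
  rewrite (opair_comull dm) Dm tpair_map transp_id.
  have -> : transp (tswap P P) (opair x y) = opair y x.
    by apply: dual_ext => t; rewrite transpE opair_swap.
  rewrite tpair_assocV -/(opair x z) (opair_comulr dm) Dm leibniz.
  by rewrite evDr; ring.
- apply: opair_inj => y z.
  by rewrite evNr opair_swap !dm (brC z y) evNr opprK.
- apply: opair3_inj => x y z; rewrite !add_lfunE comp_lfunE id_lfunE !evDr.
  rewrite !tpair_rot !(opair_comulr dm) !dm.
  by rewrite -!opprD -!evDr jacobi !ev0r oppr0.
Qed.

(** In each compatibility condition the swaps and the splittings of S and T
    cancel all adjoints; what is left is the Jacobi identity, in the first
    condition, and the Leibniz rule, in the other two. *)
Lemma dual_poisson_bialgebra : poisson_bialgebra br mul delta Delta.
Proof.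
split=> [|||x y|x y|x y];
  [exact: brP|exact: dual_poisson_coalgebra|exact: dual_asi| | |];
  apply: opair_inj => z w.
- rewrite evBr !add_lfunE !evDr !opair_mapl !opair_mapr !dm.
  rewrite (br_adj_swap (br z) x y w) (br_adj_swap (br z) y x w) om_br.
  rewrite (brC (T x z)) (brC (T y z)) !evNr.
  rewrite (adj_brE x z) (adj_brE y z) !linearD !evDr.
  by rewrite /= (jacobiE x z w) (jacobiE y z w) !evBr; ring.
- rewrite !evDr !opair_mapl !opair_mapr !dm !Dm.
  rewrite (br_adj_swap (mul z) x y w) (br_adj_swap (mul z) y x w) om_mul.
  rewrite (brC (S x z)) (brC (S y z)) !evNr.
  rewrite (adj_mulE x z) (adj_mulE y z) !linearB !evBr /=.
  rewrite !leibniz (brC w z) (brC w x) (brC w y) !bilNl.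
  by rewrite !(linearN (mul _)) /= !(mulC z) !evDr !evNr; ring.
- rewrite !evDr !add_lfunE !opp_lfunE !evDr !evNr !opair_mapl !opair_mapr.
  rewrite !dm !Dm (mulC (T x z)).
  rewrite (br_adj_swap (mul w) x y z) (br_adj_swap (mul z) x y w).
  rewrite (brC (S y z)) evNr.
  rewrite (adj_mulE y z) (adj_mulE y w) !linearB !evBr om_br /= !leibniz.
  rewrite (brC w y) (brC w x) (brC z y) (brC z x) (brC w z).
  rewrite !(mulC (br y _)) !(mulC (- _)) !(mulC (br x _)).
  by rewrite !(linearN (mul _)) /= !evDr !evNr; ring.
Qed.

End Poisson.

(** * Skew derivations *)

Section Differential.
Variables (m : nat) (D E : 'I_m -> 'End(P)).
Hypothesis D_comm : commuting D.
Hypothesis D_der : forall k, derivation mul (D k).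
Hypothesis om_D : forall k x y, ω (D k x) y = - ω x (D k y).
Hypothesis E_opp : forall k, E k = - D k.

Lemma adj_D k z : adj (D k) z = - D k z.
Proof. by apply: om_inj => w; rewrite om_adjl linearN evN om_D opprK. Qed.

Lemma adj_E k z : adj (E k) z = D k z.
Proof. by apply: om_inj => w; rewrite om_adjl E_opp opp_lfunE evNr om_D. Qed.

(** As the adjoints of D k and E k are - D k and D k, all conditions that link
    Delta with D and E express the Leibniz rule for D k. *)
Lemma dual_diff_asi (Delta : 'Hom(P, tensor P P)) :
  dualizes Delta mul -> comm_cocomm_diff_asi mul Delta D E.
Proof.
move=> Dm; split=> [||k|k l|k a|k a b|k a b|k a|k a].
- exact: dual_asi.
- exact: D_comm.
- exact: D_der.
- rewrite !E_opp; apply/lfunP => x; rewrite !comp_lfunE !opp_lfunE !linearN /=.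
  by rewrite (commutingE D_comm).
- apply: opair_inj => y z; rewrite add_lfunE evDr opair_mapl opair_mapr !Dm.
  by rewrite !adj_E E_opp opp_lfunE linearN evN om_D D_der !evDr; ring.
- by rewrite E_opp !opp_lfunE D_der bilNl opprD addrCA subrr addr0.
- by rewrite E_opp !opp_lfunE D_der linearN opprD addNKr.
- apply: opair_inj => y z; rewrite evDr opair_mapl opair_mapr !Dm.
  by rewrite adj_D adj_E om_D D_der bilNl evDr evNr; ring.
- apply: opair_inj => y z; rewrite evDr opair_mapl opair_mapr !Dm.
  by rewrite adj_D adj_E om_D D_der linearN evDr evNr; ring.
Qed.

End Differential.

Section InducedPoisson.
Variables D E : 'I_2 -> 'End(P).
Hypothesis D_comm : commuting D.
Hypothesis D_der : forall k, derivation mul (D k).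
Hypothesis om_D : forall k x y, ω (D k x) y = - ω x (D k y).
Hypothesis E_opp : forall k, E k = - D k.

(** Skewness moves both derivations of D_1 x D_2 y, and the Connes condition
    the other factor, to the remaining argument; the terms with D_1 D_2 are
    symmetric in the two derivations and cancel. *)
Lemma wronskian_cocycle : cyclic_cocycle (wronskian mul D).
Proof.
have brP := wronskian_poisson mulP D_comm D_der.
move=> x y z; have br_split : ω (wronskian mul D x y) z =
    ω x (wronskian mul D y z) - ω y (wronskian mul D x z).
  rewrite !wronskianE linearB evB !om_mul !om_D !D_der !(commutingE D_comm 1 0).
  by rewrite !evE; ring.
rewrite br_split [ω _ x]om_skew [ω (wronskian _ _ z _) _]om_skew.
by rewrite (lie_brC (pa_lie brP) z x) evNr; ring.
Qed.

Lemma dual_induces_poisson (Delta : 'Hom(P, tensor P P)) :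
    dualizes Delta mul ->
  induces_poisson_bialgebra mul Delta D E (wronskian mul D)
    (cobr (wronskian mul D) r).
Proof.
move=> Dm; have brP := wronskian_poisson mulP D_comm D_der.
split=> [a b|a||a].
- by rewrite !E_opp !opp_lfunE (commutingE D_comm).
- suff -> : (E 1 \o D 0 = E 0 \o D 1)%VF by [].
  apply/lfunP => x.
  by rewrite !comp_lfunE !E_opp !opp_lfunE (commutingE D_comm).
- by [].
- apply: opair_inj => y z; rewrite (cobr_dualizes brP wronskian_cocycle).
  rewrite add_lfunE opp_lfunE evBr !opair_map !Dm !(adj_E om_D E_opp).
  by rewrite wronskianE evBr.
Qed.

End InducedPoisson.
End ConnesCocycle.
End SkewForm.

(** * The canonical form on the sum of a space and its dual *)

Section DoubleForm.
Variables (F : fieldType) (A : vectType F).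
Local Notation hat := (A * dual A)%type.

Lemma double_form_bilinear :
  bilinear_for *:%R *:%R (fun x y : hat => ev y.2 x.1 - ev x.2 y.1 : F^o).
Proof.
split=> w k x y /=; rewrite evP (ev_linear w.2) scalerBr addrACA -opprD;
  by [].
Qed.

(** The sign is the one for which the pairing of r with double_form y and
    double_form z is double_form y z. *)
Definition double_form : 'Hom(hat, dual hat) :=
  bifun (fun x y : hat => ev y.2 x.1 - ev x.2 y.1 : F^o).

Lemma double_formE x y : ev (double_form x) y = ev y.2 x.1 - ev x.2 y.1.
Proof. by rewrite /ev /double_form bifunE//; exact: double_form_bilinear. Qed.

Lemma double_form_skew x y :
  ev (double_form x) y = - ev (double_form y) x.
Proof. by rewrite !double_formE opprB. Qed.

Variables (n : nat) (e : n.-tuple A) (es : n.-tuple (dual A)).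
Hypotheses (he : basis_of fullv e) (hes : dual_basis e es).

Lemma dual_basis_sum a : a = \sum_(i < n) ev (tnth es i) a *: tnth e i.
Proof.
have C := coord_basis he (memvf a).
rewrite [LHS]C; apply: eq_bigr => i _; rewrite -(tnth_nth 0); congr (_ *: _).
rewrite [in RHS]C ev_sum (bigD1 i)//= big1 => [|j ji];
  rewrite -(tnth_nth 0) /ev linearZ /= -/(ev _ _) hes.
  by rewrite eqxx addr0 [RHS]mulr1.
by rewrite eq_sym (negPf ji) scaler0.
Qed.

Lemma dual_basis_dual_sum (u : dual A) :
  u = \sum_(i < n) ev u (tnth e i) *: tnth es i.
Proof.
apply: dual_ext => a; rewrite [in LHS](dual_basis_sum a) ev_sum.
rewrite /ev sum_lfunE; apply: eq_bigr => i _.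
by rewrite linearZ scale_lfunE; exact: mulrC.
Qed.

(** The first half of r reproduces phi on A and the second half on the dual of
    A, by expansion in the two dual bases. *)
Lemma dual_r_casimir (phi : dual hat) z :
  ev (tpair phi (double_form z)) (dual_r e es) = ev phi z.
Proof.
case: z => a u.
have L1 : linear (fun b => ev phi (b, 0) : F^o).
  move=> k b c; rewrite -ev_linear; congr (ev phi (_, _)).
  by rewrite /= scaler0 addr0.
have L2 : linear (fun v => ev phi (0, v) : F^o).
  move=> k v w; rewrite -ev_linear; congr (ev phi (_, _)).
  by rewrite /= scaler0 addr0.
have -> : ev phi (a, u) = ev phi (a, 0) + ev phi (0, u).
  by rewrite -evDr; congr (ev phi (_, _)); rewrite ?addr0 ?add0r.
rewrite -(linE L1) -(linE L2) {2}(dual_basis_sum a) {2}(dual_basis_dual_sum u).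
rewrite !linear_sum -big_split ev_sum; apply: eq_bigr => i _ /=.
rewrite evBr !tpairE !double_formE /= !linearZ /= !linE//.
by rewrite !evE subr0 sub0r mulrN opprK mulrC [X in _ + X]mulrC.
Qed.

End DoubleForm.

Arguments double_form {F A}.

(** * The differential algebra on the sum of a Zinbiel algebra and its dual *)

Section DoubleAlgebra.
Variables (F : fieldType) (A : vectType F).
Variables (ast : 'Hom(A, 'End(A))).
Local Notation hat := (A * dual A)%type.
Local Notation mul := (zinbiel_comm ast).
Local Notation hmul := (sd_mul mul (dual_rep ast)).

Lemma double_ext (x y : hat) :
  x.1 = y.1 -> (forall c, ev x.2 c = ev y.2 c) -> x = y.
Proof. by case: x y => [a u] [b v] /= -> uv; congr (_, _); apply: dual_ext. Qed.

Lemma double_mul_ev (x y : hat) c :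
  ev (hmul x y).2 c = ev y.2 (ast x.1 c) + ev x.2 (ast y.1 c).
Proof. by rewrite sd_mulE /= evD !dual_repE !transpE. Qed.

Lemma double_mul1 (x y : hat) : (hmul x y).1 = ast x.1 y.1 + ast y.1 x.1.
Proof. by rewrite sd_mulE /= zinbiel_commE. Qed.

Lemma double_connes : cyclic_cocycle double_form hmul.
Proof.
move=> x y z; rewrite !double_formE !double_mul_ev !double_mul1 !evE.
by ring.
Qed.

(** The Zinbiel identity says that left multiplications represent the
    commutative algebra on A; their transposes then represent it on the dual. *)
Lemma double_comm_algebra : zinbiel ast -> comm_algebra hmul.
Proof.
move=> Z.
have mulC a b : mul a b = mul b a by rewrite !zinbiel_commE addrC.
have astM a b c : ast (mul a b) c = ast a (ast b c).
  by rewrite zinbiel_commE bilDl Z.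
have mulA a b c : mul a (mul b c) = mul (mul a b) c.
  rewrite [LHS]zinbiel_commE astM zinbiel_commE linearD /=.
  rewrite [RHS]zinbiel_commE astM [mul a b]zinbiel_commE linearD /= !Z.
  by apply: ev_inj => phi; rewrite !evE; ring.
split=> x y => [z|]; apply: double_ext => [|c].
- by rewrite !sd_mulE /= mulA.
- rewrite !double_mul_ev sd_mulE [in RHS]sd_mulE /= !astM.
  by rewrite -!astM (mulC y.1 x.1) (mulC z.1 x.1); ring.
- by rewrite !double_mul1 addrC.
- by rewrite !double_mul_ev addrC.
Qed.

Local Notation hend f := (sd_end f (- transp f)).

Lemma double_end_ev (f : 'End(A)) (x : hat) c :
  ev (hend f x).2 c = - ev x.2 (f c).
Proof. by rewrite sd_endE /= opp_lfunE evN transpE. Qed.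

Lemma double_end1 (f : 'End(A)) (x : hat) : (hend f x).1 = f x.1.
Proof. by rewrite sd_endE. Qed.

Lemma double_end_skew (f : 'End(A)) (x y : hat) :
  ev (double_form (hend f x)) y = - ev (double_form x) (hend f y).
Proof. by rewrite !double_formE !double_end_ev !double_end1; ring. Qed.

Lemma double_endN (f : 'End(A)) : sd_end (- f) (transp f) = - hend f.
Proof.
apply/lfunP => x; rewrite opp_lfunE !sd_endE !opp_lfunE.
by congr (_, _); rewrite /= opprK.
Qed.

Lemma double_commuting m (D : 'I_m -> 'End(A)) :
  commuting D -> commuting (fun k => hend (D k)).
Proof.
move=> D_comm k l; apply/lfunP => x; rewrite !comp_lfunE.
apply: double_ext => [|c]; first by rewrite !double_end1 (commutingE D_comm).
by rewrite !double_end_ev (commutingE D_comm).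
Qed.

Lemma double_derivation (f : 'End(A)) :
  derivation ast f -> derivation hmul (hend f).
Proof.
move=> f_der x y; apply: double_ext => [|c].
  rewrite double_end1 !sd_mulE /= !double_end1 !zinbiel_commE linearD /= !f_der.
  by rewrite [X in _ + X]addrC addrACA.
rewrite double_end_ev [RHS]evD !double_mul_ev !double_end_ev !double_end1.
by rewrite !f_der !evE; ring.
Qed.

(** On the dual part, the terms v (d_1 d_2 a * c) coming from the Leibniz rule
    cancel because d_1 and d_2 commute, and v (a <> c) remains, <> being the
    pre-Poisson operation. *)
Lemma double_wronskian (D : 'I_2 -> 'End(A)) : diff_zinbiel ast D ->
  sd_br (wronskian mul D) (- dual_rep (wronskian ast D))
    = wronskian hmul (fun k => hend (D k)).
Proof.
move=> [Z D_comm D_der]; apply/lfunP => x; apply/lfunP => y.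
rewrite [RHS]wronskianE sd_brE.
apply: double_ext => [|c] /=.
  by rewrite !sd_mulE /= !double_end1 wronskianE.
rewrite [RHS]evB !double_mul_ev !double_end_ev !double_end1.
rewrite !evE !opp_lfunE !evE.
rewrite !dual_repE !transpE !wronskianE !D_der !(commutingE D_comm 1 0) !evE.
by ring.
Qed.

End DoubleAlgebra.

Theorem proposition5p54 (F : fieldType) (char0 : [pchar F] =i pred0)
    (A : vectType F) (ast : 'Hom(A, 'End(A))) (D : 'I_2 -> 'End(A))
    (hA : diff_zinbiel ast D)
    (n : nat) (e : n.-tuple A) (es : n.-tuple (dual A))
    (he : basis_of fullv e) (hes : dual_basis e es) :
  let mul := zinbiel_comm ast in
  let br := wronskian mul D in
  let diamond := wronskian ast D in
  let hmul := sd_mul mul (dual_rep ast) in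
  let hbr := sd_br br (- dual_rep diamond) in
  let r := dual_r e es in
  let delta := cobr hbr r in
  let Delta := comul hmul r in
  let hD k := sd_end (D k) (- transp (D k)) in
  let hE k := sd_end (- D k) (transp (D k)) in
  poisson_bialgebra hbr hmul delta Delta
  /\ comm_cocomm_diff_asi hmul Delta hD hE
  /\ induces_poisson_bialgebra hmul Delta hD hE hbr delta.
Proof.
move=> mul br diamond hmul hbr r delta Delta hD hE.
have hmulP : comm_algebra hmul := double_comm_algebra (dz_zinbiel hA).
have hmulC : cyclic_cocycle double_form hmul := double_connes ast.
have hDD : commuting hD := double_commuting (dz_commuting hA).
have hDder k : derivation hmul (hD k) := double_derivation (dz_derivation hA k).
have hDskew k := double_end_skew (D k).
have hEN k : hE k = - hD k := double_endN (D k).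
have hbrE : hbr = wronskian hmul hD := double_wronskian hA.
have skew := @double_form_skew F A.
have cas := dual_r_casimir he hes.
have hbrP : poisson_algebra hbr hmul.
  by rewrite hbrE; exact: wronskian_poisson.
have hbrC : cyclic_cocycle double_form hbr.
  by rewrite hbrE; exact: (wronskian_cocycle skew cas).
have Dm : dualizes double_form Delta hmul.
  exact: (comul_dualizes skew cas hmulP hmulC).
have dm : dualizes double_form delta hbr.
  exact: (cobr_dualizes skew cas hbrP hbrC).
split.
  exact: (dual_poisson_bialgebra skew cas hmulP hmulC hbrP hbrC dm Dm).
split; first exact: (dual_diff_asi skew cas hmulP hmulC).
by rewrite /delta hbrE; exact: (dual_induces_poisson skew cas hmulP hmulC).
Qed.
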